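(* Let $(X,d,A)$ be a metric pair such that $(X/A,d_1,[A])$ is separable and not uniformly discrete, let $B=\widehat V(X,A)$ with norm $\|\cdot\|_{W_1}$, and let $(J,\Sigma)$ be admissible covariance data on $B$ with associated centered Gaussian measure $\gamma_\Sigma$ on $\ell^2$. Fix $t>0$ and let $u\sim\gamma_\Sigma$. Define, for $x,y\in B$, $$k_{J,\Sigma,t}(x,y):=\mathbb E\!\left[\exp\!\bigl(i\sqrt t\,\langle J(x-y),u\rangle_{\ell^2}\bigr)\right].$$ Then $k_{J,\Sigma,t}$ is a continuous, translation-invariant, positive definite kernel on $B$. Moreover, for all $x,y\in B$, $$k_{J,\Sigma,t}(x,y)=\exp\!\left(-\frac t2\,\|\Sigma^{1/2}J(x-y)\|_{\ell^2}^2\right).$$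
   Context: A metric pair $(X,d,A)$ is a metric space with a distinguished subset $A\subseteq X$. Put $d(x,A):=\inf_{a\in A}d(x,a)$ and $d_1(x,y):=\min\bigl(d(x,y),\,d(x,A)+d(y,A)\bigr)$. Let $X/A$ be the quotient collapsing $A$ to a point $[A]$; $d_1$ descends to $X/A$. Standing assumption: $A$ is nonempty and $d_1$ is a genuine metric on $X/A$ (i.e. $d(x,A)>0$ for $x\notin A$). A metric space is uniformly discrete if distances between distinct points are bounded below by some $\varepsilon>0$. $V(X,A):=V(X)/V(A)$, where $V(Y)$ is the free real vector space on $Y$; thus $V(X,A)$ has basis $(e_u)_{u\in X/A\setminus\{[A]\}}$. It carries the norm $\|\sum_u c_ue_u\|_{W_1}=\sup\{\sum_u c_uf(u): f\in\mathrm{Lip}_0(X/A,d_1),\ \mathrm{Lip}_{d_1}(f)\le1\}$, where $\mathrm{Lip}_0(X/A,d_1)$ is the space of real Lipschitz functions on $X/A$ vanishing at $[A]$. $B=\widehat V(X,A)$ is its Banach completion, i.e. the Lipschitz-free (Arens–Eells) space $\mathcal F(X/A,d_1)$. Admissible covariance data $(J,\Sigma)$: fix a sequence $(\ell_n)_{n\ge1}\subset B^\ast$ with $\|\ell_n\|_{B^\ast}\le1$ that is norming, i.e. $\|x\|_{W_1}=\sup_n|\ell_n(x)|$ for all $x\in B$, and a strictly positive weight sequence $(w_n)_{n\ge1}\in\ell^2$; set $J\colon B\to\ell^2$, $Jx:=(w_n\ell_n(x))_{n\ge1}$ (bounded linear). $\Sigma$ is the bounded positive self-adjoint trace-class operator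 on the real Hilbert space $\ell^2$ with $\Sigma e_n=\sigma_ne_n$ for the standard basis $(e_n)$, where $\sigma_n\ge0$ and $\sum_n\sigma_n<\infty$. $\gamma_\Sigma$ is the centered Gaussian Radon probability measure on $\ell^2$ with covariance $\Sigma$: $\int_{\ell^2}e^{i\langle h,u\rangle}\,d\gamma_\Sigma(u)=\exp(-\tfrac12\langle\Sigma h,h\rangle)$ for all $h\in\ell^2$. Positive definite means $\sum_{j,k=1}^mc_j\overline{c_k}\,k(x_j,x_k)\ge0$ for all $m$, $x_1,\dots,x_m\in B$, $c_1,\dots,c_m\in\mathbb C$; translation-invariant means $k(x+z,y+z)=k(x,y)$ for all $x,y,z\in B$. *)

(* Defs.v *)
From HB Require Import structures.
From mathcomp Require Import all_boot all_order all_algebra generic_quotient.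
From mathcomp Require Import all_classical all_reals all_analysis.
From mathcomp Require Import complex ring lra.
Set Implicit Arguments.
Unset Strict Implicit.
Unset Printing Implicit Defensive.
Import Order.TTheory GRing.Theory Num.Theory.
Import numFieldNormedType.Exports.
Local Open Scope classical_set_scope.
Local Open Scope quotient_scope.
Local Open Scope ring_scope.

Section set_distance.
Context {R : realType} {X : metricType R}.
Implicit Types (A : set X) (x y : X).

Definition set_dist A x : R := inf [set mdist x a | a in A].

Definition collapse_dist A x y : R :=
  Order.min (mdist x y) (set_dist A x + set_dist A y).

Lemma set_dist_has_lbound A x : has_lbound [set mdist x a | a in A].
Proof. by exists 0 => _ [a _ <-]; exact: mdist_ge0. Qed.

Lemma set_dist_ge0 A x : 0 <= set_dist A x.
Proof.
have [->|/set0P[a Aa]] := eqVneq A set0; first by rewrite /set_dist image_set0 inf0.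
by apply: lb_le_inf; [exists (mdist x a), a|move=> _ [b _ <-]; exact: mdist_ge0].
Qed.

Lemma set_dist_in A x : A x -> set_dist A x = 0.
Proof.
move=> Ax; apply/eqP; rewrite eq_le set_dist_ge0 andbT.
by apply: ge_inf; [exact: set_dist_has_lbound|exists x => //; exact: mdistxx].
Qed.

Lemma set_dist_le A x y : A !=set0 -> set_dist A x <= mdist x y + set_dist A y.
Proof.
move=> [a Aa]; rewrite -lerBlDl; apply: lb_le_inf; first by exists (mdist y a), a.
move=> _ [b Ab <-]; rewrite lerBlDl; apply: le_trans (metric_triangle x y b).
by apply: ge_inf; [exact: set_dist_has_lbound|exists b].
Qed.

Lemma collapse_dist_ge0 A x y : 0 <= collapse_dist A x y.
Proof. by rewrite le_min mdist_ge0 addr_ge0// set_dist_ge0. Qed.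

Lemma collapse_distC A x y : collapse_dist A x y = collapse_dist A y x.
Proof. by rewrite /collapse_dist metric_sym addrC. Qed.

Lemma collapse_dist_triangle A x y z : A !=set0 ->
  collapse_dist A x z <= collapse_dist A x y + collapse_dist A y z.
Proof.
move=> A0; rewrite /collapse_dist.
have := metric_triangle x y z.
have := set_dist_le x y A0; have := set_dist_le z y A0.
rewrite (metric_sym z y).
have := set_dist_ge0 A x; have := set_dist_ge0 A y; have := set_dist_ge0 A z.
have := mdist_ge0 x y; have := mdist_ge0 y z.
move: (mdist _ _) (mdist _ _) (mdist _ _) (set_dist _ _) (set_dist _ _)
  (set_dist _ _) => a b c d e f *.
by rewrite !minEle; do 3 case: ifPn => //; rewrite -?ltNge => *; lra.
Qed.

End set_distance.

(* The last field makes [collapse_dist] a genuine metric on X/A. *)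
Record metric_pair (R : realType) := MetricPair {
  space :> metricType R ;
  sub : set space ;
  sub_nonempty : sub !=set0 ;
  set_dist_gt0 : forall x, ~ sub x -> 0 < set_dist sub x }.

Section collapse.
Context {R : realType} (P : metric_pair R).
Implicit Types x y : P.

Definition collapse_rel : rel P :=
  [rel x y | `[< x = y \/ sub x /\ sub y >]].

Lemma collapse_rel_refl : reflexive collapse_rel.
Proof. by move=> x; apply/asboolP; left. Qed.

Lemma collapse_rel_sym : symmetric collapse_rel.
Proof. by move=> x y; apply/asboolP/asboolP => -[->|[]]; [left|right|left|right]. Qed.

Lemma collapse_rel_trans : transitive collapse_rel.
Proof.
move=> y x z /asboolP xy /asboolP yz; apply/asboolP.
case: xy yz => [->//|[Ax Ay]] [<-|[_ Az]]; by right.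
Qed.

Canonical collapse_equiv :=
  EquivRel collapse_rel collapse_rel_refl collapse_rel_sym collapse_rel_trans.

Definition collapse : Type := {eq_quot collapse_equiv}.

HB.instance Definition _ := Choice.on collapse.
HB.instance Definition _ := EqQuotient.on collapse.

Definition basepoint : collapse := \pi_collapse (sval (cid (sub_nonempty P))).

(* d_1 on X/A, computed on representatives; [collapse_mdistE] below shows that
   the choice of representatives does not matter. *)
Definition collapse_mdist (u v : collapse) : R :=
  collapse_dist (@sub R P) (repr u) (repr v).

Lemma collapse_dist_eq x x' y :
  collapse_rel x x' -> collapse_dist (@sub R P) x y = collapse_dist (@sub R P) x' y.
Proof.
move=> /asboolP[->//|[Ax Ax']].
have h a : sub a -> collapse_dist (@sub R P) a y = set_dist (@sub R P) y.
  move=> Aa; rewrite /collapse_dist (set_dist_in Aa) add0r; apply/min_idPr.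
  apply: le_trans (set_dist_le y a (sub_nonempty P)) _.
  by rewrite (set_dist_in Aa) addr0 metric_sym.
by rewrite !h.
Qed.

Lemma collapse_mdistE x y :
  collapse_mdist (\pi_collapse x) (\pi_collapse y) = collapse_dist (@sub R P) x y.
Proof.
have h z : collapse_rel (repr (\pi_collapse z)) z.
  by have /eqP := reprK (\pi_collapse z); rewrite piE.
by rewrite /collapse_mdist (collapse_dist_eq _ (h x)) collapse_distC
  (collapse_dist_eq _ (h y)) collapse_distC.
Qed.

Lemma collapse_mdistxx u : collapse_mdist u u = 0.
Proof.
apply/eqP; rewrite eq_le collapse_dist_ge0 andbT.
by rewrite ge_min mdistxx lexx.
Qed.

Lemma collapse_mdist_positivity u v : collapse_mdist u v = 0 -> u = v.
Proof.
rewrite -[u]reprK -[v]reprK collapse_mdistE.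
move: (repr u) (repr v) => x y d0; apply/eqP; rewrite piE; apply/asboolP.
have := collapse_dist_ge0 (@sub R P) x y.
move: d0; rewrite /collapse_dist minEle; case: ifPn => _.
  by move=> /mdist_positivity ->; left.
move=> d0 _; right.
have := set_dist_ge0 (@sub R P) x; have := set_dist_ge0 (@sub R P) y.
by split; apply: contrapT => /set_dist_gt0; lra.
Qed.

Lemma collapse_mdist_sym u v : collapse_mdist u v = collapse_mdist v u.
Proof. exact: collapse_distC. Qed.

Lemma collapse_mdist_triangle v u w :
  collapse_mdist u w <= collapse_mdist u v + collapse_mdist v w.
Proof. by apply: collapse_dist_triangle; exact: sub_nonempty. Qed.

HB.instance Definition _ := isMetric.Build R collapse collapse_mdistxx
  collapse_mdist_positivity collapse_mdist_sym collapse_mdist_triangle.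

End collapse.

Definition separable (T : topologicalType) :=
  exists D : set T, countable D /\ dense D.

Definition uniformly_discrete (R : realType) (T : metricType R) :=
  exists2 e : R, 0 < e & forall x y : T, x <> y -> e <= mdist x y.

Section virtual.
Context {R : realType} (P : metric_pair R).

(* V(X, A), with basis (e_u) indexed by the points u <> [A] of X/A: a vector
   \sum_u c_u e_u is encoded by its coefficient function c, extended by
   c [A] = 0. *)
Definition virtual_pred : {pred (collapse P -> R : lmodType R)} :=
  [pred c | `[< finite_set [set u | c u != 0] /\ c (basepoint P) = 0 >]].

Record virtual := Virtual {
  coef :> collapse P -> R ;
  _ : coef \in virtual_pred }.

HB.instance Definition _ := [isSub for coef].
HB.instance Definition _ := [Choice of virtual by <:].

Lemma virtual_submod_closed : GRing.submod_closed virtual_pred.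
Proof.
split => [|a c d /asboolP[fc c0] /asboolP[fd d0]]; apply/asboolP; split => //.
- rewrite (_ : [set _ | _] = set0) //; apply/seteqP; split => u //=.
  by rewrite eqxx.
- apply: (@sub_finite_set _ _ ([set u | c u != 0] `|` [set u | d u != 0])).
    move=> u /=; rewrite !fctE; have [->|] := eqVneq (c u) 0; last by left.
    by rewrite scaler0 add0r; right.
  by rewrite finite_setU.
- by rewrite !fctE c0 d0 scaler0 addr0.
Qed.

HB.instance Definition _ :=
  GRing.isSubmodClosed.Build _ _ virtual_pred virtual_submod_closed.
HB.instance Definition _ := [SubChoice_isSubLmodule of virtual by <:].

Definition lip0_ball : set (collapse P -> R) :=
  [set f | f (basepoint P) = 0 /\ forall u v, `|f u - f v| <= mdist u v].

Definition W1_norm (c : virtual) : R :=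
  sup [set \sum_(u \in [set: collapse P]) c u * f u | f in lip0_ball].

(* A Banach completion of (V(X, A), W1_norm). It is unique up to a linear
   isometry extending the identity of V(X, A), and no particular construction
   of it is singled out. *)
Record banach_completion := BanachCompletion {
  completion :> completeNormedModType R ;
  embed : {linear virtual -> completion} ;
  embed_isometry : forall c, `|embed c| = W1_norm c ;
  embed_dense : dense (range embed) }.

End virtual.

Section l2.
Context {R : realType}.

Definition l2_pred : {pred (nat -> R : lmodType R)} :=
  [pred f : nat -> R | `[< cvgn (series (fun n => f n ^+ 2)) >]].

Record l2 := L2 { l2_val :> nat -> R ; _ : l2_val \in l2_pred }.

HB.instance Definition _ := [isSub for l2_val].
HB.instance Definition _ := [Choice of l2 by <:].

Lemma l2_submod_closed : GRing.submod_closed l2_pred.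
Proof.
split => [|a f g /asboolP cf /asboolP cg]; apply/asboolP.
  rewrite (_ : series _ = cst 0); first exact: is_cvg_cst.
  apply/funext => n; rewrite /series /= big1// => i _.
  by rewrite expr0n.
apply: (@series_le_cvg _ _
  ((2 * a ^+ 2) *: (fun n => f n ^+ 2) + (2 : R) *: (fun n => g n ^+ 2))).
- by move=> n; exact: sqr_ge0.
- move=> n; have H (b x y : R) : 0 <= 2 * b ^+ 2 * x ^+ 2 + 2 * y ^+ 2.
    by have := sqr_ge0 (b * x); have := sqr_ge0 y; rewrite !expr2; lra.
  exact: H.
- move=> n; have H (b x y : R) :
      (b * x + y) ^+ 2 <= 2 * b ^+ 2 * x ^+ 2 + 2 * y ^+ 2.
    by have := sqr_ge0 (b * x - y); rewrite !expr2; nra.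
  exact: H.
- by apply: is_cvg_seriesD; apply: is_cvg_seriesZ.
Qed.

HB.instance Definition _ := GRing.isSubmodClosed.Build _ _ l2_pred l2_submod_closed.
HB.instance Definition _ := [SubChoice_isSubLmodule of l2 by <:].

Definition inner (u v : l2) : R := limn (series (fun n => u n * v n)).

Lemma l2P (u : l2) : cvgn (series (fun n => u n ^+ 2)).
Proof. by case: u => u /= /asboolP. Qed.

Lemma inner_cvg (u v : l2) : cvgn (series (fun n => u n * v n)).
Proof.
apply: (@normed_cvg _ R^o).
apply: (@series_le_cvg _ _ ((fun n => u n ^+ 2) + (fun n => v n ^+ 2))).
- by move=> n; exact: normr_ge0.
- by move=> n; rewrite !fctE addr_ge0// sqr_ge0.
- move=> n; have H (x y : R) : `|x * y| <= x ^+ 2 + y ^+ 2.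
    have := sqr_ge0 (x - y); have := sqr_ge0 (x + y).
    by case: (ger0P (x * y)); rewrite !expr2; nra.
  exact: H.
- by apply: is_cvg_seriesD; exact: l2P.
Qed.

Lemma innerC u v : inner u v = inner v u.
Proof. by rewrite /inner; under eq_fun do rewrite mulrC. Qed.

Lemma innerDl u v w : inner (u + v) w = inner u w + inner v w.
Proof.
rewrite /inner -lim_seriesD; [|exact: inner_cvg|exact: inner_cvg].
by congr (limn (series _)); apply/funext => n; rewrite -mulrDl.
Qed.

Lemma innerZl a u v : inner (a *: u) v = a * inner u v.
Proof.
rewrite /inner -[RHS]/(a *: _) -lim_seriesZ; last exact: inner_cvg.
by congr (limn (series _)); apply/funext => n; rewrite !fctE /GRing.scale /= mulrA.
Qed.

Lemma inner_ge (u : l2) n : u n ^+ 2 <= inner u u.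
Proof.
have -> : inner u u = limn (series (fun n => u n ^+ 2)) by [].
apply: (@le_trans _ _ (series (fun n => u n ^+ 2) n.+1)).
  by rewrite seriesSr lerDr sumr_ge0// => i _; exact: sqr_ge0.
apply: nondecreasing_cvgn_le; last exact: l2P.
by apply: nondecreasing_series => i _ _; exact: sqr_ge0.
Qed.

Lemma inner_ge0 u : 0 <= inner u u.
Proof. exact: le_trans (sqr_ge0 (u 0)) (inner_ge u 0). Qed.

Definition l2_norm (u : l2) : R := Num.sqrt (inner u u).

Lemma l2_norm_ge0 u : 0 <= l2_norm u.
Proof. exact: sqrtr_ge0. Qed.

Lemma sqr_l2_norm u : l2_norm u ^+ 2 = inner u u.
Proof. by rewrite sqr_sqrtr// inner_ge0. Qed.

Lemma l2_norm_eq0 u : l2_norm u = 0 -> u = 0.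
Proof.
move=> u0; apply/val_inj/funext => n /=.
have := inner_ge u n; rewrite -sqr_l2_norm u0 expr0n /= => h.
by apply/eqP; rewrite -sqrf_eq0 eq_le h sqr_ge0.
Qed.

Lemma inner_comb a b u v : inner (a *: u + b *: v) (a *: u + b *: v) =
  a ^+ 2 * inner u u + 2 * (a * b) * inner u v + b ^+ 2 * inner v v.
Proof.
rewrite innerDl !innerZl ![inner _ (_ + _)]innerC !innerDl !innerZl (innerC v u).
by rewrite !expr2; lra.
Qed.

Lemma cauchy_schwarz u v : inner u v <= l2_norm u * l2_norm v.
Proof.
have [/l2_norm_eq0 -> | u0] := eqVneq (l2_norm u) 0.
  by rewrite -(scale0r 0) innerZl mul0r mulr_ge0 ?l2_norm_ge0.
have [/l2_norm_eq0 -> | v0] := eqVneq (l2_norm v) 0.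
  by rewrite innerC -(scale0r 0) innerZl mul0r mulr_ge0 ?l2_norm_ge0.
have up : 0 < l2_norm u by rewrite lt_neqAle eq_sym u0 l2_norm_ge0.
have vp : 0 < l2_norm v by rewrite lt_neqAle eq_sym v0 l2_norm_ge0.
have := inner_ge0 (l2_norm v *: u + (- l2_norm u) *: v).
rewrite inner_comb -!sqr_l2_norm.
rewrite (_ : _ + _ =
  2 * (l2_norm u * l2_norm v) * (l2_norm u * l2_norm v - inner u v)); last first.
  by rewrite !expr2; ring.
by rewrite pmulr_rge0 ?subr_ge0// !mulr_gt0.
Qed.

Lemma l2_norm_triangle u v : l2_norm (u + v) <= l2_norm u + l2_norm v.
Proof.
rewrite -(@ler_pXn2r _ 2)// ?nnegrE ?addr_ge0 ?l2_norm_ge0//.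
rewrite sqr_l2_norm -[u]scale1r -[v]scale1r inner_comb !scale1r -!sqr_l2_norm.
by have := cauchy_schwarz u v; rewrite !expr2; lra.
Qed.

Lemma l2_normZ a u : l2_norm (a *: u) = `|a| * l2_norm u.
Proof.
rewrite /l2_norm innerZl innerC innerZl mulrA -expr2 sqrtrM ?sqr_ge0//.
by rewrite sqrtr_sqr.
Qed.

HB.instance Definition _ := @Lmodule_isNormed.Build R l2 l2_norm
  l2_norm_triangle l2_normZ l2_norm_eq0.

Lemma basis_subproof n : (fun k => (k == n)%:R : R) \in l2_pred.
Proof.
apply/asboolP; apply: (is_cvg_near_cst (1 : R)); exists n.+1 => // m /= nm.
rewrite /series /= (bigD1_seq n) ?iota_uniq ?mem_index_iota //=.
by rewrite eqxx expr1n big1 ?addr0// => i /negPf ->; rewrite expr0n.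
Qed.

Definition basis_vec n : l2 := L2 (basis_subproof n).

Definition positive_op (T : l2 -> l2) := forall u, 0 <= inner (T u) u.
Definition self_adjoint (T : l2 -> l2) := forall u v, inner (T u) v = inner u (T v).
(* For a positive operator T one has |T| = T, so that T is trace class iff
   \sum_n <T e_n, e_n> is finite. *)
Definition positive_trace_class (T : l2 -> l2) :=
  positive_op T /\ cvgn (series (fun n => inner (T (basis_vec n)) (basis_vec n))).

Definition is_sqrt_op (T : l2 -> l2) (S : {linear l2 -> l2}) :=
  [/\ continuous S, positive_op S, self_adjoint S & forall u, S (S u) = T u].

End l2.
Arguments l2 : clear implicits.

Definition dual_norm (R : realType) (B : normedModType R) (l : {scalar B}) : \bar R :=
  ereal_sup [set `|l x|%:E | x in [set x : B | `|x| <= 1]].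

Record covariance_data (R : realType) (B : normedModType R) := CovarianceData {
  ell : nat -> {scalar B} ;
  ell_continuous : forall n, continuous (ell n) ;
  ell_norm_le1 : forall n, (dual_norm (ell n) <= 1)%E ;
  ell_norming : forall x : B, `|x| = sup [set `|ell n x| | n in [set: nat]] ;
  weight : l2 R ;
  weight_gt0 : forall n, 0 < weight n ;
  sigma : nat -> R ;
  sigma_ge0 : forall n, 0 <= sigma n ;
  sigma_summable : cvgn (series sigma) ;
  Sigma : {linear l2 R -> l2 R} ;
  Sigma_continuous : continuous Sigma ;
  Sigma_self_adjoint : self_adjoint Sigma ;
  Sigma_trace_class : positive_trace_class Sigma ;
  Sigma_diagonal : forall n, Sigma (basis_vec n) = sigma n *: basis_vec n }.

Section covariance_map.
Context {R : realType} {B : normedModType R} (D : covariance_data B).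

Lemma ell_le n x : `|ell D n x| <= `|x|.
Proof.
have [->|x0] := eqVneq x 0; first by rewrite linear0 !normr0.
have := ell_norm_le1 D n; rewrite /dual_norm => h.
have xp : 0 < `|x| by rewrite normr_gt0.
have : (`|ell D n (`|x|^-1 *: x)|%:E <= 1)%E.
  apply: le_trans h; apply: ereal_sup_ubound; exists (`|x|^-1 *: x) => //=.
  by rewrite normrZ normfV normr_id mulVf ?gt_eqF.
rewrite linearZ /= lee_fin normrM normfV normr_id.
by rewrite mulrC ler_pdivrMr// mul1r.
Qed.

Lemma J_subproof x : (fun n => weight D n * ell D n x) \in l2_pred.
Proof.
apply/asboolP; apply: (@series_le_cvg _ _ (`|x| ^+ 2 *: (fun n => weight D n ^+ 2))).
- by move=> n; exact: sqr_ge0.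
- by move=> n; rewrite !fctE /GRing.scale /= mulr_ge0 ?sqr_ge0.
- move=> n; rewrite !fctE /GRing.scale /= exprMn mulrC ler_wpM2r ?sqr_ge0//.
  by rewrite -[leLHS]real_normK ?num_real// ler_pXn2r ?nnegrE// ell_le.
- by apply: is_cvg_seriesZ; exact: l2P.
Qed.

Definition J (x : B) : l2 R := L2 (J_subproof x).

End covariance_map.

Notation borel_l2 R := (g_sigma_algebraType (@open (l2 R))).

Section complex_integral.
Context {R : realType}.
Local Open Scope complex_scope.

Definition cexp (z : R[i]) : R[i] :=
  (expR (complex.Re z))%:C * (cos (complex.Im z) +i* sin (complex.Im z)).

Definition cintegral d (T : measurableType d) (mu : {measure set T -> \bar R})
    (f : T -> R[i]) : R[i] :=
  Rintegral mu setT (fun x => complex.Re (f x)) +i* Rintegral mu setT (fun x => complex.Im (f x)).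

Definition radon (gamma : probability (borel_l2 R) R) :=
  forall E : set (borel_l2 R), measurable E ->
    gamma E = ereal_sup [set gamma K | K in
      [set K : set (borel_l2 R) | compact (K : set (l2 R)) /\ K `<=` E]].

Definition centered_gaussian (T : l2 R -> l2 R) (gamma : probability (borel_l2 R) R) :=
  radon gamma /\
  forall h : l2 R, cintegral gamma (fun u : borel_l2 R => cexp ('i%C * (inner h u)%:C)) =
    (expR (- (1 / 2) * inner (T h) h))%:C.

Definition gaussian_kernel (B : normedModType R) (D : covariance_data B) (t : R)
    d (Omega : measurableType d) (P : probability Omega R) (u : {RV P >-> borel_l2 R})
    (x y : B) : R[i] :=
  cintegral P (fun omega => cexp ('i%C * (Num.sqrt t * inner (J D (x - y)) (u omega))%:C)).

Definition positive_definite (B : Type) (k : B -> B -> R[i]) :=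
  forall (m : nat) (x : 'I_m -> B) (c : 'I_m -> R[i]),
    0 <= \sum_(i < m) \sum_(j < m) c i * (c j)^* * k (x i) (x j).

Definition translation_invariant (B : zmodType) (k : B -> B -> R[i]) :=
  forall x y z, k (x + z) (y + z) = k x y.

(* [R[i]^o] is R[i] with the topology of the modulus. *)
Definition continuous_kernel (B : topologicalType) (k : B -> B -> R[i]) :=
  continuous (fun p : B * B => k p.1 p.2 : R[i]^o).

End complex_integral.

(* Main.v *)
Require Import Defs.
From HB Require Import structures.
From mathcomp Require Import all_boot all_order all_algebra.
From mathcomp Require Import all_classical all_reals all_analysis.
From mathcomp Require Import measurable_realfun complex.
From mathcomp Require Import ring.
Import Order.TTheory GRing.Theory Num.Theory.
Import numFieldNormedType.Exports.
Local Open Scope classical_set_scope.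
Local Open Scope ring_scope.

(** Write a_x for the real random variable sqrt t <J x, u>. As J is linear, the
    kernel is k(x, y) = E[e^(i (a_x - a_y))], and e^(i (a_x - a_y)) is the product
    of e^(i a_x) by the conjugate of e^(i a_y) ([cexp_iB]).

    Such a kernel is positive definite whatever the law of the a_x: as the
    complex integral is linear, the sum of the c_i conj(c_j) k(x_i, x_j) is the
    expectation of the squared modulus of the sum of the c_i e^(i a_(x_i)), and
    the integral of a nonnegative function is nonnegative
    ([phase_kernel_positive_definite]).

    The closed formula comes from the law of u. The functional <h, .> is
    continuous, hence Borel, so the expectation can be computed under the
    Gaussian measure ([cintegral_distribution]), whose characteristic function
    at h = sqrt t J(x - y) is exp(- <Sigma h, h> / 2) ([gaussian_kernelE]).
    A self-adjoint square root S of Sigma turns <Sigma h, h> into the square of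
    the norm of S h ([sqrt_op_norm]).

    Continuity is read on this formula: J is bounded by the norm of the weight
    sequence ([J_bound]), Sigma is bounded, and the inner product is jointly
    continuous ([cvg_inner]). Translation invariance is immediate. *)

(** * Integration of complex-valued functions *)

Section cintegral_theory.
Local Open Scope complex_scope.
Context {R : realType} {d : measure_display} {T : measurableType d}.
Context (mu : {measure set T -> \bar R}).
Implicit Types f g : T -> R[i].

Definition cintegrable f :=
  mu.-integrable setT (EFin \o (fun x => complex.Re (f x))) /\
  mu.-integrable setT (EFin \o (fun x => complex.Im (f x))).

Lemma cintegrable0 : cintegrable (fun=> 0).
Proof. by split; exact: integrable0. Qed.

Lemma cintegrableD f g :
  cintegrable f -> cintegrable g -> cintegrable (fun x => f x + g x).
Proof.
move=> [fr fi] [gr gi]; split.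
  rewrite (_ : _ \o _ = (EFin \o fun x => complex.Re (f x)) \+
    (EFin \o fun x => complex.Re (g x)))%E; first exact: integrableD.
  by apply/funext => x /=; case: (f x) (g x) => [a b] [a' b'].
rewrite (_ : _ \o _ = (EFin \o fun x => complex.Im (f x)) \+
  (EFin \o fun x => complex.Im (g x)))%E; first exact: integrableD.
by apply/funext => x /=; case: (f x) (g x) => [a b] [a' b'].
Qed.

Lemma cintegralD f g : cintegrable f -> cintegrable g ->
  cintegral mu (fun x => f x + g x) = cintegral mu f + cintegral mu g.
Proof.
move=> [fr fi] [gr gi]; rewrite /cintegral; simpc.
rewrite -!RintegralD//.
by congr (_ +i* _); apply: eq_Rintegral => x _; case: (f x) (g x) => [a b] [a' b'].
Qed.

Let integrableZ (k : R) (h : T -> R) : mu.-integrable setT (EFin \o h) ->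
  mu.-integrable setT (EFin \o (fun x => k * h x)).
Proof.
move=> ih; rewrite (_ : _ \o _ = (fun x => k%:E * (h x)%:E)%E) //.
exact: integrableZl.
Qed.

Lemma cintegrableZ c f : cintegrable f -> cintegrable (fun x => c * f x).
Proof.
case: c => p q [fr fi].
have rp := integrableZ p _ fr; have rq := integrableZ q _ fr.
have ip := integrableZ p _ fi; have iq := integrableZ q _ fi.
split.
  rewrite (_ : _ \o _ = (EFin \o fun x => (p * complex.Re (f x))%R) \-
    (EFin \o fun x => (q * complex.Im (f x))%R))%E; first exact: integrableB.
  by apply/funext => x /=; case: (f x).
rewrite (_ : _ \o _ = (EFin \o fun x => (p * complex.Im (f x))%R) \+
  (EFin \o fun x => (q * complex.Re (f x))%R))%E; first exact: integrableD.
by apply/funext => x /=; case: (f x).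
Qed.

Lemma cintegralZ c f : cintegrable f ->
  cintegral mu (fun x => c * f x) = c * cintegral mu f.
Proof.
case: c => p q [fr fi].
have rp := integrableZ p _ fr; have rq := integrableZ q _ fr.
have ip := integrableZ p _ fi; have iq := integrableZ q _ fi.
rewrite /cintegral; simpc.
rewrite -!RintegralZl// -RintegralD// -RintegralB//.
by congr (_ +i* _); apply: eq_Rintegral => x _; case: (f x).
Qed.

(** Integrability of the sum is proved jointly with the formula, so that the
    lemma can be iterated on double sums. *)
Lemma cintegral_sum {I : Type} (r : seq I) {F : I -> T -> R[i]} :
  (forall i, cintegrable (F i)) ->
  cintegrable (fun x => \sum_(i <- r) F i x) /\
  cintegral mu (fun x => \sum_(i <- r) F i x) = \sum_(i <- r) cintegral mu (F i).
Proof.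
move=> iF; elim: r => [|i r [ir IHr]].
  split; first by under eq_fun do rewrite big_nil; exact: cintegrable0.
  under eq_fun do rewrite big_nil.
  by rewrite big_nil /cintegral /= Rintegral_cst//= !mul0r.
under eq_fun do rewrite big_cons; rewrite big_cons -IHr.
by split; [exact: cintegrableD|exact: cintegralD].
Qed.

(** In the order of [R[i]] a nonnegative number is real, hence the integral of
    a nonnegative function has zero imaginary part. *)
Lemma cintegral_ge0 f : (forall x, 0 <= f x) -> 0 <= cintegral mu f.
Proof.
move=> f0; rewrite /cintegral lecE /=; apply/andP; split.
  rewrite (_ : (fun x => complex.Im (f x)) = fun=> 0).
    by rewrite Rintegral_cst//= mul0r.
  by apply/funext => x; exact: ger0_Im.
by apply: Rintegral_ge0 => x _; have := f0 x; rewrite lecE => /andP[].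
Qed.

End cintegral_theory.

(** * Unimodular phases *)

Section phase.
Local Open Scope complex_scope.
Context {R : realType}.

Lemma cexp_i (a : R) : cexp ('i%C * a%:C) = cos a +i* sin a.
Proof. by rewrite /cexp /=; simpc; rewrite expR0; simpc. Qed.

(** The kernel e^(i(a - b)) is the rank-one kernel z_a * conj z_b: this is the
    source of positive definiteness. *)
Lemma cexp_iB (a b : R) :
  cexp ('i%C * (a - b)%:C) = cexp ('i%C * a%:C) * (cexp ('i%C * b%:C))^*.
Proof.
rewrite !cexp_i; simpc; rewrite cosB sinB; congr (_ +i* _).
by ring.
Qed.

(** Sine and cosine are bounded, and a probability measure is finite. *)
Lemma cexp_cintegrable {d} {T : measurableType d} (P : probability T R) {a : T -> R} :
  measurable_fun setT a -> cintegrable P (fun x => cexp ('i%C * (a x)%:C)).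
Proof.
move=> ma; under eq_fun do rewrite cexp_i.
have bounded_integrable (g : R -> R) : continuous g -> (forall x, `|g x| <= 1) ->
    P.-integrable setT (EFin \o (fun x => g (a x))).
  move=> cg g1; apply: measurable_bounded_integrable => //.
  - exact: fin_num_fun_lty.
  - by apply: measurableT_comp ma; exact: continuous_measurable_fun.
  - exists 1; split => // M M1 x _ /=; exact: le_trans (g1 _) (ltW M1).
split; apply: bounded_integrable => [|x].
- exact: continuous_cos.
- by rewrite ler_norml cos_geN1 cos_le1.
- exact: continuous_sin.
- by rewrite ler_norml sin_geN1 sin_le1.
Qed.

(** The radius [e] of a ball of [R[i]^o] is a positive complex number; it must
    be recognized as a real one before the topology of [R] can be used. *)
Lemma continuous_real_complex : continuous (fun x : R => x%:C : R[i]^o).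
Proof.
move=> x; apply/cvgrPdist_lt => e e0.
move: (e0); rewrite ltcE => /andP[/eqP e_im e_re].
have -> : e = (complex.Re e)%:C by case: e e_im {e0 e_re} => a b /= ->.
near=> y; rewrite -rmorphB normc_def /= expr0n addr0 sqrtr_sqr ltcR.
by near: y; exact: cvgr_dist_lt.
Unshelve. all: by end_near. Qed.

End phase.

(** * The Hilbert space of square-summable sequences *)

Section hilbert.
Context {R : realType}.
Implicit Types u v : l2 R.

Lemma sqr_normE u : `|u| ^+ 2 = inner u u.
Proof. exact: sqr_l2_norm. Qed.

Lemma polarization u v : inner u v = 4^-1 * (`|u + v| ^+ 2 - `|u - v| ^+ 2).
Proof.
rewrite !sqr_normE -[u]scale1r -[v]scale1r -scaleNr !inner_comb !scale1r.
by field.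
Qed.

(** By polarization the joint continuity of the inner product reduces to that
    of the norm and of the vector space operations. *)
Lemma cvg_inner {T : Type} {F : set_system T} {FF : Filter F}
    (f g : T -> l2 R) u v :
  f @ F --> u -> g @ F --> v -> inner (f x) (g x) @[x --> F] --> inner u v.
Proof.
move=> fu gv; rewrite polarization; under eq_fun do rewrite polarization.
apply: cvgM; first exact: cvg_cst.
by apply: cvgB; rewrite !expr2; apply: cvgM; apply: cvg_norm;
  [exact: cvgD|exact: cvgD|exact: cvgB|exact: cvgB].
Qed.

Lemma inner_continuous u : continuous (inner u).
Proof.
move=> v; apply: (@cvg_inner _ (nbhs v) _ (fun=> u) id).
  exact: cvg_cst.
exact: cvg_id.
Qed.

(** It suffices to test measurability on open intervals, which generate the
    Borel sets of the line. *)
Lemma continuous_measurable_l2 (f : l2 R -> R) :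
  continuous f -> measurable_fun setT (f : borel_l2 R -> R).
Proof.
move=> /continuousP cf; apply: (measurability _ (RGenOpens.measurableE R)).
move=> _ [_ [a [b ->] <-]]; rewrite setTI.
apply: sub_sigma_algebra; exact/cf/interval_open.
Qed.

Lemma sqrt_op_norm {T : l2 R -> l2 R} {S : {linear l2 R -> l2 R}} :
  is_sqrt_op T S -> forall h, `|S h| ^+ 2 = inner (T h) h.
Proof. by move=> [_ _ saS SS] h; rewrite sqr_normE -saS SS. Qed.

End hilbert.

(** * The map J and the covariance form *)

Section covariance.
Context {R : realType} {B : normedModType R} (D : covariance_data B).

Lemma J_is_linear : linear (J D).
Proof.
move=> a x y; apply/val_inj/funext => n /=.
rewrite [LHS]/= linearP /= mulrDr !fctE /=.
by rewrite /GRing.scale /= mulrCA.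
Qed.

HB.instance Definition _ := GRing.isLinear.Build R B (l2 R) _ (J D) J_is_linear.

(** Coordinate by coordinate, since every [ell D n] has norm at most 1. *)
Lemma J_bound x : `|J D x| <= `|weight D| * `|x|.
Proof.
rewrite -(@ler_pXn2r _ 2) ?nnegrE ?mulr_ge0// exprMn !sqr_normE.
(* The product by a scalar is seen as scaling, to push it inside the series. *)
rewrite mulrC -[leRHS]/(_ *: _) -lim_seriesZ; last exact: inner_cvg.
apply: ler_lim.
- exact: inner_cvg.
- by apply: is_cvg_seriesZ; exact: inner_cvg.
near=> n; apply: ler_sum => i _ /=.
rewrite !fctE /GRing.scale /= -!expr2 exprMn mulrC.
rewrite ler_wpM2r ?sqr_ge0//.
by rewrite -[leLHS]real_normK ?num_real// ler_pXn2r ?nnegrE// ell_le.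
Unshelve. all: by end_near. Qed.

Lemma J_continuous : continuous (J D).
Proof.
apply: bounded_linear_continuous; apply/linear_boundedP.
exists `|weight D|; split => // r /ltW wr x.
by apply: le_trans (J_bound x) _; rewrite ler_wpM2r.
Qed.

Lemma covariance_form_continuous :
  continuous (fun x => inner (Sigma D (J D x)) (J D x)).
Proof.
move=> x; have Jx := J_continuous x; apply: cvg_inner => //.
apply: (@continuous_comp _ _ _ (J D) (Sigma D)) => //; exact: Sigma_continuous.
Qed.

End covariance.

(** * Kernels given by random phases *)

Section random_phase.
Local Open Scope complex_scope.
Context {R : realType}.

(** Change of variables: the expectation of a function of [u] depends only on
    the law of [u]. *)
Lemma cintegral_distribution {d} {Omega : measurableType d} (P : probability Omega R)
    {d'} {T : measurableType d'} (u : {RV P >-> T}) {gamma : probability T R}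
    {f : T -> R[i]} :
  (forall E, measurable E -> distribution P u E = gamma E) ->
  measurable_fun setT (fun x => complex.Re (f x)) ->
  measurable_fun setT (fun x => complex.Im (f x)) ->
  cintegrable P (f \o u) ->
  cintegral P (f \o u) = cintegral gamma f.
Proof.
move=> lawu mr mi [ir ii].
have transport (g : T -> R) : measurable_fun setT g ->
    P.-integrable setT (EFin \o (g \o u)) ->
    Rintegral P setT (g \o u) = Rintegral gamma setT g.
  move=> mg ig; congr fine.
  rewrite -[LHS](@integral_distribution _ _ _ _ _ P u (EFin \o g))//.
    by apply: eq_measure_integral => E mE _; exact: lawu.
  exact/measurable_EFinP.
by rewrite /cintegral -(transport _ mr ir) -(transport _ mi ii).
Qed.

(** The quadratic form of the kernel is the expectation of the squared modulus
    of the sum of the c_i e^(i a_i). *)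
Lemma phase_kernel_positive_definite d (Omega : measurableType d)
    (P : probability Omega R) (B : Type) (a : B -> Omega -> R) :
  (forall x, measurable_fun setT (a x)) ->
  positive_definite (fun x y =>
    cintegral P (fun omega => cexp ('i%C * (a x omega - a y omega)%:C))).
Proof.
move=> ma m x c.
pose F i j omega := c i * (c j)^* *
  cexp ('i%C * (a (x i) omega - a (x j) omega)%:C).
have iE i j := cexp_cintegrable P (measurable_funB (ma (x i)) (ma (x j))).
have iF i j : cintegrable P (F i j) by apply: cintegrableZ; exact: iE.
have sF i := cintegral_sum P (index_enum 'I_m) (iF i).
have [_ sum_integral] :=
  cintegral_sum P (index_enum 'I_m) (fun i => (sF i).1).
have -> : \sum_(i < m) \sum_(j < m) c i * (c j)^* *
    cintegral P (fun omega => cexp ('i%C * (a (x i) omega - a (x j) omega)%:C)) =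
    cintegral P (fun omega => \sum_(i < m) \sum_(j < m) F i j omega).
  rewrite sum_integral; apply: eq_bigr => i _; rewrite (sF i).2.
  by apply: eq_bigr => j _; rewrite cintegralZ//; exact: iE.
apply: cintegral_ge0 => omega.
rewrite [leRHS](_ : _ = (\sum_i c i * cexp ('i%C * (a (x i) omega)%:C)) *
  (\sum_i c i * cexp ('i%C * (a (x i) omega)%:C))^*); first exact: mulcJ_ge0.
rewrite rmorph_sum mulr_suml; apply: eq_bigr => i _.
rewrite mulr_sumr; apply: eq_bigr => j _.
(* [rmorphM] and [rmorph_sum] leave conjugation in its closed-field form, which
   is convertible but not syntactically equal to the one of [cexp_iB]. *)
by rewrite /F cexp_iB [_ (c j * _)]rmorphM mulrACA; reflexivity.
Qed.

End random_phase.

(** * The Gaussian kernel *)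

Section kernel.
Local Open Scope complex_scope.
Context {R : realType} {B : normedModType R} (D : covariance_data B).
Context {t : R} (ht : 0 < t).
Context {d : measure_display} {Omega : measurableType d}.
Context (P : probability Omega R).
Context (u : {RV P >-> borel_l2 R}).

Lemma measurable_inner h : measurable_fun setT (inner h : borel_l2 R -> R).
Proof. by apply: continuous_measurable_l2; exact: inner_continuous. Qed.

Lemma measurable_inner_RV h : measurable_fun setT (fun omega => inner h (u omega)).
Proof. by apply: measurableT_comp (measurable_inner h) _. Qed.

(** The kernel is the Fourier transform of the law of [u] at the vector
    h = sqrt t J(x - y), and the covariance form is quadratic in h. *)
Lemma gaussian_kernelE {gamma : probability (borel_l2 R) R} :
  centered_gaussian (Sigma D) gamma ->
  (forall E, measurable E -> distribution P u E = gamma E) ->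
  forall x y, gaussian_kernel D t u x y =
    (expR (- (t / 2) * inner (Sigma D (J D (x - y))) (J D (x - y))))%:C.
Proof.
move=> [_ charfun] lawu x y; rewrite /gaussian_kernel.
set z := J D (x - y); pose h := Num.sqrt t *: z.
have -> : - (t / 2) * inner (Sigma D z) z = - (1 / 2) * inner (Sigma D h) h.
  rewrite /h [Sigma D (_ *: _)]linearZ /= innerZl (innerC _ (_ *: z)) innerZl.
  rewrite (innerC z) !mulrA -[_ * _ * Num.sqrt t]mulrA -expr2.
  by rewrite sqr_sqrtr ?(ltW ht)//; field.
rewrite -charfun -(cintegral_distribution P u lawu).
- under eq_fun do rewrite -innerZl.
  by [].
- under eq_fun do rewrite cexp_i /=.
  apply: measurableT_comp (measurable_inner h).
  by apply: continuous_measurable_fun; exact: continuous_cos.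
- under eq_fun do rewrite cexp_i /=.
  apply: measurableT_comp (measurable_inner h).
  by apply: continuous_measurable_fun; exact: continuous_sin.
- exact: cexp_cintegrable (measurable_inner_RV h).
Qed.

End kernel.

Theorem theorem4p3 (R : realType) (X : metric_pair R)
    (hsep : separable (collapse X))
    (hnud : ~ uniformly_discrete (collapse X))
    (B : banach_completion X)
    (D : covariance_data B)
    (gamma : probability (borel_l2 R) R)
    (hgamma : centered_gaussian (Sigma D) gamma)
    (t : R) (ht : 0 < t)
    (d : measure_display) (Omega : measurableType d) (P : probability Omega R)
    (u : {RV P >-> borel_l2 R})
    (hu : forall E : set (borel_l2 R), measurable E -> distribution P u E = gamma E) :
  [/\ continuous_kernel (gaussian_kernel D t u),
      translation_invariant (gaussian_kernel D t u),
      positive_definite (gaussian_kernel D t u) &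
      forall root : {linear l2 R -> l2 R}, is_sqrt_op (Sigma D) root ->
      forall x y : B,
        gaussian_kernel D t u x y
        = ((expR (- (t / 2) * `|root (J D (x - y))| ^+ 2))%:C)%C].
Proof.
have kE := gaussian_kernelE D ht P u hgamma hu.
split.
- rewrite /continuous_kernel; under eq_fun do rewrite kE.
  pose q (p : B * B) := inner (Sigma D (J D (p.1 - p.2))) (J D (p.1 - p.2)).
  have q_continuous : continuous q.
    move=> p; apply: (@continuous_comp _ _ _ (fun p : B * B => p.1 - p.2)
      (fun z => inner (Sigma D (J D z)) (J D z))).
      by apply: cvgB; [exact: cvg_fst|exact: cvg_snd].
    exact: covariance_form_continuous.
  move=> p; apply: (@continuous_comp _ _ _ (fun p => expR (- (t / 2) * q p))
    (fun r : R => r%:C%C : R[i]^o)); last exact: continuous_real_complex.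
  apply: (@continuous_comp _ _ _ (fun p => - (t / 2) * q p) expR);
    last exact: continuous_expR.
  by apply: cvgM; [exact: cvg_cst|exact: q_continuous].
- by move=> x y z; rewrite /gaussian_kernel opprD addrACA subrr addr0.
- pose a (x : B) omega := Num.sqrt t * inner (J D x) (u omega).
  have -> : gaussian_kernel D t u = fun x y =>
      cintegral P (fun omega => cexp ('i%C * (a x omega - a y omega)%:C)%C).
    apply/funext => x; apply/funext => y; rewrite /gaussian_kernel.
    congr (cintegral P _); apply/funext => omega; congr (cexp ('i%C * _%:C)%C).
    by rewrite /a linearB /= -scaleN1r innerDl innerZl; ring.
  apply: phase_kernel_positive_definite => x.
  by apply: measurable_funM => //; exact: measurable_inner_RV.
- by move=> root rootP x y; rewrite kE (sqrt_op_norm rootP).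
Qed.
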